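(* Let $Y$ be a topological space, let $X$ be a subspace of $Y$, and let $\Gamma\in\{\mathbf{\Sigma}^0_\alpha,\mathbf{\Sigma}^1_n,\mathbf{\Pi}^1_n\mid 1\le\alpha<\omega_1,\ 1\le n<\omega\}$. Then every $\Gamma$-measurable function $f:X\to P\omega$ can be extended to a $\Gamma$-measurable function $g:Y\to P\omega$.
   Context: $P\omega$ is the power set of $\omega$ with the Scott topology (basic open sets $\{A\subseteq\omega\mid F\subseteq A\}$, $F$ finite). A function $f:X\to Z$ is $\Gamma$-measurable if $f^{-1}(U)\in\Gamma(X)$ for every open $U\subseteq Z$. Let $\mathcal{N}=\omega^\omega$ be the Baire space. For an arbitrary topological space $X$: $\mathbf{\Sigma}^0_0(X)=\{\emptyset\}$; $\mathbf{\Sigma}^0_1(X)$ = open sets; $\mathbf{\Sigma}^0_2(X)$ = countable unions of sets $U\setminus V$ with $U,V$ open; for $2<\alpha<\omega_1$, $\mathbf{\Sigma}^0_\alpha(X)$ = countable unions of sets whose complements lie in $\bigcup_{\beta<\alpha}\mathbf{\Sigma}^0_\beta(X)$; $\mathbf{\Pi}^0_\alpha(X)$ = complements. $\mathbf{\Sigma}^1_1(X)=\{pr_X(A)\mid A\in\mathbf{\Pi}^0_2(\mathcal{N}\times X)\}$, $\mathbf{\Sigma}^1_{n+1}(X)=\{pr_X(A)\mid A\in\mathbf{\Pi}^1_n(\mathcal{N}\times X)\}$ with $pr_X(A)=\{x\mid\exists p\in\mathcal{N}\,(p,x)\in A\}$; $\mathbf{\Pi}^1_n(X)$ = complements of $\mathbf{\Sigma}^1_n(X)$-sets.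 *)

(* Defs.v *)
From HB Require Import structures.
From mathcomp Require Import all_boot all_order all_algebra.
From mathcomp Require Import all_classical all_reals all_analysis.

Set Implicit Arguments.
Unset Strict Implicit.
Unset Printing Implicit Defensive.

Local Open Scope classical_set_scope.

(* Codes for the countable ordinals: [czero] denotes 0 and [csup f] denotes
   sup_n (f n + 1).  Distinct codes may denote the same ordinal, so codes are
   compared with [cle], [clt] and [ceq], never with [=].  These make the codes
   a well-order (up to [ceq]), and by [cord_rank] every countable well-order is
   represented by codes. *)
Inductive cord : Set :=
  | czero : cord
  | csup : (nat -> cord) -> cord.

Definition csucc (a : cord) : cord := csup (fun=> a).

Definition cfin (n : nat) : cord := iter n csucc czero.

(* f n < sup_m (g m + 1) iff f n <= g m for some m *)
Fixpoint cle (a b : cord) {struct a} : Prop :=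
  match a with
  | czero => True
  | csup f => forall n,
      match b with
      | czero => False
      | csup g => exists m, cle (f n) (g m)
      end
  end.

Definition clt (a b : cord) : Prop := cle (csucc a) b.

Definition ceq (a b : cord) : Prop := cle a b /\ cle b a.

Lemma cle_refl a : cle a a.
Proof. by elim: a => //= f IH n; exists n. Qed.

Lemma cle_trans a b c : cle a b -> cle b c -> cle a c.
Proof.
elim: a b c => [//|f IH] [|g] c fg gh /= n; first by case: (fg 0).
have [m fgm] := fg n; case: c gh => [|h] gh; first by case: (gh 0).
by have [k ghk] := gh m; exists k; apply: IH ghk.
Qed.

Lemma clt_csup a g : clt a (csup g) <-> exists n, cle a (g n).
Proof. by split=> [/(_ 0)|H _]. Qed.

Lemma csup_le f b : cle (csup f) b <-> forall n, clt (f n) b.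
Proof. by split=> [H n _|H n]; [exact: (H n)|exact: (H n 0)]. Qed.

Lemma cle_clt_total a b : cle a b \/ clt b a.
Proof.
suff: (cle a b \/ clt b a) /\ (cle b a \/ clt a b) by case.
elim: a b => [|f IH] b.
  split; first by left.
  by case: b => [|g]; [left|right; apply/clt_csup; exists 0].
have D c : cle (csup f) c \/ clt c (csup f).
  have [H|H] := pselect (exists n, cle c (f n)); first by right; apply/clt_csup.
  left; apply/csup_le => n; have [_ [cf|//]] := IH n c.
  by case: H; exists n.
split=> //; case: b => [|g]; first by left.
have [H|H] := pselect (exists n, cle (csup f) (g n)); first by right; apply/clt_csup.
left; apply/csup_le => n; have [fg|//] := D (g n).
by case: H; exists n.
Qed.

Lemma clt_wf : well_founded clt.
Proof.
suff H a b : cle b a -> Acc clt b by move=> a; apply: (H a); apply: cle_refl.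
elim: a b => [|f IH] b ba; constructor=> c cb.
- by case: (cle_trans cb ba 0).
- by have /clt_csup [n /IH] := cle_trans cb ba.
Qed.

(* [rk x] is the supremum of the [rk y + 1] for [y] below [x]. *)
Lemma cord_rank (T : countType) (R : T -> T -> Prop) : well_founded R ->
  exists rk : T -> cord,
    forall x b, clt b (rk x) <-> exists2 y, R y x & cle b (rk y).
Proof.
move=> Rwf.
have step x (rk : forall y, R y x -> cord) :
    exists a, forall b, clt b a <-> exists y (Ryx : R y x), cle b (rk y Ryx).
  have [[y0 R0]|R0] := pselect (exists y, R y x); last first.
    exists czero => b; split=> [/(_ 0)//|[y [Ryx _]]].
    by case: R0; exists y.
  exists (csup (fun n => if unpickle n is Some y then
    if pselect (R y x) is left Ryx then rk y Ryx else rk y0 R0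
    else rk y0 R0)) => b.
  rewrite clt_csup; split=> [[n]|[y [Ryx ble]]].
    case: unpickle => [y|]; last by exists y0, R0.
    by case: pselect => [Ryx|_]; [exists y, Ryx|exists y0, R0].
  exists (pickle y); rewrite pickleK; case: pselect => // Ryx'.
  by rewrite (Prop_irrelevance Ryx' Ryx).
pose F x rk := projT1 (cid (step x rk)).
have FP x rk b : clt b (F x rk) <-> exists y (Ryx : R y x), cle b (rk y Ryx).
  by rewrite /F; case: cid.
exists (Fix Rwf (fun=> cord) F) => x b; rewrite Fix_eq; last first.
  move=> {}x f g fg; congr F; apply: functional_extensionality_dep => y.
  exact: functional_extensionality_dep.
by rewrite FP; split=> [[y [Ryx]]|[y Ryx]]; [exists y|exists y, Ryx].
Qed.

Definition pointclass := forall T : topologicalType, set (set T).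

Inductive Sigma0_at (T : topologicalType) : cord -> set T -> Prop :=
  | Sigma0_zero a : ceq a (cfin 0) -> Sigma0_at a set0
  | Sigma0_one a U : ceq a (cfin 1) -> open U -> Sigma0_at a U
  | Sigma0_two a (U V : nat -> set T) : ceq a (cfin 2) ->
      (forall n, open (U n)) -> (forall n, open (V n)) ->
      Sigma0_at a (\bigcup_n (U n `\` V n))
  | Sigma0_gt2 a (A : nat -> set T) (b : nat -> cord) : clt (cfin 2) a ->
      (forall n, clt (b n) a) -> (forall n, Sigma0_at (b n) (~` A n)) ->
      Sigma0_at a (\bigcup_n A n).

Definition Sigma0 (a : cord) : pointclass := fun T A => Sigma0_at a A.

Definition Pi0 (a : cord) : pointclass := fun T A => Sigma0 a (~` A).

Definition baire_space : Type := prod_topology (fun _ : nat => nat).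

HB.instance Definition _ := Pointed.on baire_space.
HB.instance Definition _ := Nbhs.on baire_space.
HB.instance Definition _ := Topological.on baire_space.

Definition pr (T : Type) (B : set (baire_space * T)) : set T :=
  [set x | exists p, B (p, x)].

(* The projective classes are indexed by n >= 1; index 0 is a dummy. *)
Fixpoint Sigma1 (n : nat) : pointclass := fun T =>
  match n with
  | 0 => set0
  | 1 => [set pr B | B in @Pi0 (cfin 2) (baire_space * T)%type]
  | m.+1 => [set pr B | B in [set C | @Sigma1 m (baire_space * T)%type (~` C)]]
  end.

Definition Pi1 (n : nat) : pointclass := fun T A => Sigma1 n (~` A).

Inductive boldface : pointclass -> Prop :=
  | boldface_Sigma0 a : cle (cfin 1) a -> boldface (Sigma0 a)
  | boldface_Sigma1 n : (1 <= n)%N -> boldface (Sigma1 n)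
  | boldface_Pi1 n : (1 <= n)%N -> boldface (Pi1 n).

Definition pc_measurable (G : pointclass) (X Z : topologicalType)
    (f : X -> Z) : Prop :=
  forall U : set Z, open U -> G X (f @^-1` U).

Definition Pomega : Type := set nat.

HB.instance Definition _ := Choice.on Pomega.

Definition Pomega_basic (F : set nat) : set Pomega := [set A | F `<=` A].

Lemma Pomega_basic_cover : \bigcup_(F in @finite_set nat) Pomega_basic F = setT.
Proof. by apply/seteqP; split=> // A _; exists set0. Qed.

Lemma Pomega_basic_join F G (A : Pomega) : finite_set F -> finite_set G ->
  Pomega_basic F A -> Pomega_basic G A ->
  exists H, [/\ finite_set H, Pomega_basic H A &
    Pomega_basic H `<=` Pomega_basic F `&` Pomega_basic G].
Proof.
move=> Ffin Gfin FA GA; exists (F `|` G); split.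
- by rewrite finite_setU.
- by move=> n [/FA|/GA].
- by move=> B FGB; split=> n ?; apply: FGB; [left|right].
Qed.

HB.instance Definition _ :=
  isBaseTopological.Build Pomega Pomega_basic_cover Pomega_basic_join.

(* Main.v *)
(** All the classes involved contain the empty set and the whole space, are
    closed under countable unions and binary intersections, and are such that
    every set of the class in a subspace X of Y is the trace on X of a set of
    the class in Y.  Choosing B_n in Gamma(Y) with trace {x | n \in f x}, the
    map g y = {n | y \in B_n} extends f, and the preimage under g of an open
    set is a countable union of finite intersections of the B_n.

    For the projective classes, the traces come from the fact that N * X is a
    subspace of N * Y, and the closure under countable unions and intersections
    is propagated through projections by coding: the union of the pr(C_n) is the
    projection of {(p, x) | (shift p, x) \in C_(p 0)}, and their intersection
    the projection of {(p, x) | ((p)_n, x) \in C_n for all n}. *)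
Require Import Defs.
From mathcomp Require Import all_boot all_order all_algebra.
From mathcomp Require Import all_classical all_reals all_analysis.

Set Implicit Arguments.
Unset Strict Implicit.
Unset Printing Implicit Defensive.

Local Open Scope classical_set_scope.

(** * Enumeration of pairs and the order of ordinal codes *)

Definition unpair (k : nat) : nat * nat := odflt (0, 0) (unpickle k).

Lemma unpairK (p : nat * nat) : unpair (pickle p) = p.
Proof. by rewrite /unpair pickleK. Qed.

Lemma bigcup_unpair (T : Type) (A : nat -> nat -> set T) :
  \bigcup_k A (unpair k).1 (unpair k).2 = \bigcup_i \bigcup_j A i j.
Proof.
apply/seteqP; split=> [x [k _ Ax]|x [i _ [j _ Ax]]].
  by exists (unpair k).1 => //; exists (unpair k).2.
by exists (pickle (i, j)) => //; rewrite unpairK.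
Qed.

Lemma clt_le_trans a b c : clt a b -> cle b c -> clt a c.
Proof. exact: cle_trans. Qed.

Lemma clt_irrefl a : ~ clt a a.
Proof.
by elim/(well_founded_ind clt_wf): a => a IH aa; exact: (IH a aa aa).
Qed.

Lemma cle_csucc a : cle a (csucc a).
Proof.
elim: a => [//|f IH] n; exists 0; apply: cle_trans (IH n) _ => _.
by exists n; exact: cle_refl.
Qed.

Lemma clt_cle a b : clt a b -> cle a b.
Proof. exact/cle_trans/cle_csucc. Qed.

Lemma cle_fin m n : (m <= n)%N -> cle (cfin m) (cfin n).
Proof.
move/subnK <-; elim: (n - m) => [|k IH]; first exact: cle_refl.
by apply: cle_trans IH _; exact: cle_csucc.
Qed.

Lemma cle_fin_leq m n : cle (cfin m) (cfin n) -> (m <= n)%N.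
Proof.
move=> mn; rewrite leqNgt; apply/negP => nm; apply: (@clt_irrefl (cfin n)).
exact: cle_trans (cle_fin nm) mn.
Qed.

Lemma clt_directed a b c : clt b a -> clt c a ->
  exists d, [/\ clt d a, cle b d & cle c d].
Proof.
move=> ba ca; have [bc|/clt_cle cb] := cle_clt_total b c.
  by exists c; split=> //; exact: cle_refl.
by exists b; split=> //; exact: cle_refl.
Qed.

(** * Closure properties of the Borel classes *)

Section Sigma0.
Variable T : topologicalType.
Implicit Types (A B U V : set T).

(** Only level 0 has the empty set as a constructor. At level 1 it is an open set, at level 2 a
    union of empty differences, and above 2 a union of sets with open complement. *)
Lemma Sigma0_set0 a : Sigma0 a (set0 : set T).
Proof.
have [a2|a2] := cle_clt_total a (cfin 2); last first.
  have -> : set0 = \bigcup_(_ : nat) (set0 : set T).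
    by rewrite bigcup0.
  apply: (@Sigma0_gt2 _ _ _ (fun=> cfin 1)) => // n.
    (* By definition [clt (cfin 2) a] is [cle (cfin 3) a], and the goal [clt (cfin 1) a] is
       [cle (cfin 2) a]. *)
    by apply: cle_trans a2; exact: (@cle_fin 2 3).
  by apply: Sigma0_one; [split; exact: cle_refl|rewrite setC0; exact: openT].
have [a1|a1] := cle_clt_total a (cfin 1); last first.
  have -> : set0 = \bigcup_(_ : nat) (set0 `\` (set0 : set T)).
    by rewrite setDv bigcup0.
  by apply: Sigma0_two => // _; exact: open0.
have [a0|a0] := cle_clt_total a (cfin 0); first exact: Sigma0_zero.
by apply: Sigma0_one => //; exact: open0.
Qed.

(** The complement is the union of [setT \ U] and [V \ set0], again differences of open sets. This
    is how level 2 embeds into the higher levels, in spaces where open sets need not be countable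
    unions of closed sets. *)
Lemma Sigma0_setCD U V : open U -> open V -> Sigma0 (cfin 2) (~` (U `\` V)).
Proof.
move=> oU oV.
have -> : ~` (U `\` V) =
    \bigcup_k (bigcup2 setT V k `\` bigcup2 U set0 k).
  rewrite setDE setCI setCK.
  apply/seteqP; split=> [x [Ux|Vx]|x [[|[|k]] _ [? ?]]] //.
  - by exists 0.
  - by exists 1; split=> // -[].
  - by left.
  - by right.
apply: Sigma0_two; first by split; exact: cle_refl.
- by move=> [|[|k]] //=; [exact: openT|exact: open0].
- by move=> [|[|k]] //=; exact: open0.
Qed.

Lemma Sigma0_bigcupD a (U V : nat -> set T) : cle (cfin 2) a ->
  (forall n, open (U n)) -> (forall n, open (V n)) ->
  Sigma0 a (\bigcup_n (U n `\` V n)).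
Proof.
move=> a2 oU oV; have [a2'|{}a2] := cle_clt_total a (cfin 2).
  exact: Sigma0_two.
apply: (@Sigma0_gt2 _ _ _ (fun=> cfin 2)) => // n.
exact: Sigma0_setCD.
Qed.

Lemma Sigma0_open a U : cle (cfin 1) a -> open U -> Sigma0 a U.
Proof.
move=> a1 oU; have [a1'|a2] := cle_clt_total a (cfin 1).
  exact: Sigma0_one.
have -> : U = \bigcup_(_ : nat) (U `\` set0) by rewrite setD0 bigcup_const.
by apply: Sigma0_bigcupD => // _; exact: open0.
Qed.

Lemma Sigma0_mono a b A : cle a b -> Sigma0 a A -> Sigma0 b A.
Proof.
move=> ab SA; case: SA ab => {a A} [a a0|a U [_ a1] oU|
  a U V [_ a2] oU oV|a A c a2 ca SA] ab.
- exact: Sigma0_set0.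
- by apply: Sigma0_open => //; exact: cle_trans ab.
- by apply: Sigma0_bigcupD => //; exact: cle_trans ab.
- apply: Sigma0_gt2 SA; first exact: cle_trans ab.
  by move=> n; exact: clt_le_trans (ca n) ab.
Qed.

Lemma Sigma0_open_inv a A : cle a (cfin 1) -> Sigma0 a A -> open A.
Proof.
move=> a1 SA; case: SA a1 => {a A} [a a0|a U _ oU|
  a U V [_ a2] _ _|a A c a2 _ _] a1 //.
- exact: open0.
- by have := cle_fin_leq (cle_trans a2 a1).
- by have := @cle_fin_leq 3 1 (cle_trans a2 a1).
Qed.

Lemma Sigma0_bigcupD_inv a A : cle a (cfin 2) -> Sigma0 a A ->
  exists UV : nat -> set T * set T,
    (forall n, open (UV n).1 /\ open (UV n).2) /\
    A = \bigcup_n ((UV n).1 `\` (UV n).2).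
Proof.
move=> a2 SA; case: SA a2 => {a A} [a a0|a U _ oU|
  a U V _ oU oV|a A c a2' _ _] a2 //.
- exists (fun=> (set0, set0)); split; first by move=> n; split; exact: open0.
  by rewrite /= setDv bigcup0.
- exists (fun=> (U, set0)); split; first by move=> n; split=> //; exact: open0.
  by rewrite /= setD0 bigcup_const.
- by exists (fun n => (U n, V n)); split=> // n; split; [exact: oU|exact: oV].
- by have := @cle_fin_leq 3 2 (cle_trans a2' a2).
Qed.

(** A normal form above level 2: the first three constructors are turned into unions of differences
    of open sets, whose complements have level 2. *)
Lemma Sigma0_gt2_inv a A : clt (cfin 2) a -> Sigma0 a A ->
  exists Bb : nat -> set T * cord,
    (forall n, clt (Bb n).2 a /\ Sigma0 (Bb n).2 (~` (Bb n).1)) /\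
    A = \bigcup_n (Bb n).1.
Proof.
move=> a2 SA.
have D (U V : nat -> set T) :
    (forall n, open (U n)) -> (forall n, open (V n)) ->
    exists Bb : nat -> set T * cord,
      (forall n, clt (Bb n).2 a /\ Sigma0 (Bb n).2 (~` (Bb n).1)) /\
      \bigcup_n (U n `\` V n) = \bigcup_n (Bb n).1.
  move=> oU oV; exists (fun n => (U n `\` V n, cfin 2)); split=> // n /=.
  by split=> //; exact: Sigma0_setCD.
case: SA a2 D => {a A} [a _|a U _ oU|a U V _ oU oV|a A c _ ca Sc] a2 D.
- have -> : set0 = \bigcup_(_ : nat) (set0 `\` (set0 : set T)).
    by rewrite setDv bigcup0.
  by apply: D => _; exact: open0.
- have -> : U = \bigcup_(_ : nat) (U `\` set0) by rewrite setD0 bigcup_const.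
  by apply: D => // _; exact: open0.
- exact: D oU oV.
- by exists (fun n => (A n, c n)); split=> // n; split; [exact: ca|exact: Sc].
Qed.

Lemma Sigma0_bigcup a (A : nat -> set T) : cle (cfin 1) a ->
  (forall n, Sigma0 a (A n)) -> Sigma0 a (\bigcup_n A n).
Proof.
move=> a1 SA; have [a2|a2] := cle_clt_total a (cfin 2); last first.
  have [Bb BbP] := choice (fun n => Sigma0_gt2_inv a2 (SA n)).
  under eq_bigcupr do rewrite (BbP _).2.
  (* The double sequence of normal forms is flattened into a single one. *)
  rewrite -(bigcup_unpair (fun n m => (Bb n m).1)).
  apply: (@Sigma0_gt2 _ _ _ (fun k => (Bb (unpair k).1 (unpair k).2).2)) => //.
    by move=> k; case: ((BbP (unpair k).1).1 (unpair k).2).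
  by move=> k; case: ((BbP (unpair k).1).1 (unpair k).2).
have [a1'|{}a1] := cle_clt_total a (cfin 1).
  apply: Sigma0_open => //; apply: bigcup_open => n _.
  exact: Sigma0_open_inv (SA n).
have [UV UVP] := choice (fun n => Sigma0_bigcupD_inv a2 (SA n)).
under eq_bigcupr do rewrite (UVP _).2.
rewrite -(bigcup_unpair (fun n m => (UV n m).1 `\` (UV n m).2)).
apply: Sigma0_bigcupD => // k;
  by case: ((UVP (unpair k).1).1 (unpair k).2).
Qed.

Lemma Sigma0_setU a A B : cle (cfin 1) a ->
  Sigma0 a A -> Sigma0 a B -> Sigma0 a (A `|` B).
Proof.
move=> a1 SA SB; rewrite -bigcup2E; apply: Sigma0_bigcup => // -[|[|n]] //=.
exact: Sigma0_set0.
Qed.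

Lemma Sigma0_setI a A B : cle (cfin 1) a ->
  Sigma0 a A -> Sigma0 a B -> Sigma0 a (A `&` B).
Proof.
have bigcupI (F G : nat -> set T) : (\bigcup_n F n) `&` (\bigcup_n G n) =
    \bigcup_k (F (unpair k).1 `&` G (unpair k).2).
  rewrite (bigcup_unpair (fun n m => F n `&` G m)) setI_bigcupl.
  by apply: eq_bigcupr => n _; rewrite setI_bigcupr.
move=> a1 SA SB; have [a2|a2] := cle_clt_total a (cfin 2); last first.
  have [Ff [FfP ->]] := Sigma0_gt2_inv a2 SA.
  have [Gg [GgP ->]] := Sigma0_gt2_inv a2 SB.
  rewrite bigcupI; set I := fun k => _ `&` _.
  (* The complement of [I k] is a union of two sets of levels below [a]. Both are raised to a common
     level [c] below [a], taken at least 1 so that its class is closed under unions. *)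
  have /choice[c cP] k : exists c, clt c a /\ Sigma0 c (~` I k).
    have [fa SF] := FfP (unpair k).1; have [ga SG] := GgP (unpair k).2.
    have [d [da Fd Gd]] := clt_directed fa ga.
    have [c [ca dc c1]] := clt_directed da (clt_cle a2 : clt (cfin 1) a).
    exists c; split=> //; rewrite setCI; apply: Sigma0_setU => //.
      exact: Sigma0_mono (cle_trans Fd dc) SF.
    exact: Sigma0_mono (cle_trans Gd dc) SG.
  by apply: (@Sigma0_gt2 _ _ _ c) => // k; case: (cP k).
have [a1'|{}a1] := cle_clt_total a (cfin 1).
  apply: Sigma0_open => //; apply: openI; first exact: Sigma0_open_inv SA.
  exact: Sigma0_open_inv SB.
have [F [FP ->]] := Sigma0_bigcupD_inv a2 SA.
have [G [GP ->]] := Sigma0_bigcupD_inv a2 SB.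
rewrite bigcupI.
(* (U \ V) ∩ (U' \ V') = (U ∩ U') \ (V ∪ V'). *)
under eq_bigcupr do rewrite !setDE setIACA -setCU -setDE.
apply: Sigma0_bigcupD => // k;
  have [oF oF'] := FP (unpair k).1; have [oG oG'] := GP (unpair k).2.
- exact: openI.
- exact: openU.
Qed.

End Sigma0.

(** * Preimages and traces *)

Lemma Sigma0_preimage (X Y : topologicalType) (h : X -> Y) a (A : set Y) :
  continuous h -> Sigma0 a A -> Sigma0 a (h @^-1` A).
Proof.
move/continuousP=> hc; elim=> {a A} [a a0|a U a1 oU|
  a U V a2 oU oV|a A b a2 ba _ SA].
- exact: Sigma0_zero.
- by apply: Sigma0_one => //; exact: hc.
- by rewrite preimage_bigcup; apply: Sigma0_two => // n; exact: hc.
- rewrite preimage_bigcup; exact: Sigma0_gt2 SA.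
Qed.

(** Abstracts the inclusion of a subspace, so that traces can also be taken along the induced map
    from N * X to N * Y. *)
Definition initial_map (X Y : topologicalType) (h : X -> Y) :=
  forall U, open U -> exists2 V, open V & h @^-1` V = U.

(** Preimages commute with unions, differences and complements, so the construction of [A] is
    repeated in [Y] from open sets with the given traces. *)
Lemma Sigma0_trace (X Y : topologicalType) (h : X -> Y) a (A : set X) :
  initial_map h -> Sigma0 a A -> exists2 B, Sigma0 a B & h @^-1` B = A.
Proof.
move=> hi; elim=> {a A} [a a0|a U a1 /hi[V oV <-]|
  a U V a2 oU oV|a A b a2 ba _ SA].
- by exists set0; [exact: Sigma0_zero|rewrite preimage_set0].
- by exists V => //; exact: Sigma0_one.
- have /choice[U' U'P] n : exists W, open W /\ h @^-1` W = U n.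
    by have [W] := hi _ (oU n); exists W.
  have /choice[V' V'P] n : exists W, open W /\ h @^-1` W = V n.
    by have [W] := hi _ (oV n); exists W.
  exists (\bigcup_n (U' n `\` V' n)).
    by apply: Sigma0_two => // n; [case: (U'P n)|case: (V'P n)].
  rewrite preimage_bigcup; apply: eq_bigcupr => n _.
  by rewrite -(U'P n).2 -(V'P n).2.
- have /choice[B BP] n : exists B, Sigma0 (b n) B /\ h @^-1` B = ~` A n.
    by have [B] := SA n; exists B.
  exists (\bigcup_n ~` B n).
    by apply: (Sigma0_gt2 a2 ba) => n; rewrite setCK; case: (BP n).
  rewrite preimage_bigcup; apply: eq_bigcupr => n _.
  by rewrite -preimage_setC (BP n).2 setCK.
Qed.

Lemma initial_set_val (Y : topologicalType) (X : set Y) :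
  initial_map (set_val : X -> Y).
Proof. by move=> U [V]; exists V. Qed.

(** Take the union of all open sets whose preimage lies in [W]. It reaches every point of [W], since
    around each one there is an open box in [W] whose second side is the trace of an open set of
    [Y]. *)
Lemma initial_pair_snd (Z X Y : topologicalType) (h : X -> Y) : initial_map h ->
  initial_map (fun q : Z * X => (q.1, h q.2) : Z * Y).
Proof.
move=> hi W oW; set H := fun q : Z * X => _.
exists (\bigcup_(V in [set V | open V /\ H @^-1` V `<=` W]) V).
  by apply: bigcup_open => V [].
apply/seteqP; split=> [q [V [_]]|[z x] Wzx]; first exact.
have := oW; rewrite openE => /(_ _ Wzx)[[/= P Q] [Pz Qx] PQW].
move: Pz Qx; rewrite /= !nbhsE.
move=> -[P' [oP' P'z] P'P] [Q' [/hi[Q'' oQ'' <-] Q'x] Q'Q].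
exists (P' `*` Q'') => //; split.
  rewrite openE => -[z' y] [/= P'z' Q''y]; exists (P', Q'') => //=.
  by split; apply: open_nbhs_nbhs.
by move=> [z' x'] [/= ? ?]; apply: PQW; split; [exact: P'P|exact: Q'Q].
Qed.

(** * Abstract closure conditions and the projective classes *)

(** These conditions hold for [Pi0 (cfin 2)] and are what [projection] requires of a class. *)
Record Pi_like (P : pointclass) : Prop := {
  Pi_preimage (X Y : topologicalType) (h : X -> Y) (A : set Y) :
    continuous h -> P Y A -> P X (h @^-1` A);
  Pi_trace (X Y : topologicalType) (h : X -> Y) (A : set X) :
    initial_map h -> P X A -> exists2 B, P Y B & h @^-1` B = A;
  Pi_clopen (X : topologicalType) (U : set X) : open U -> open (~` U) -> P X U;
  Pi_setU (X : topologicalType) (A B : set X) : P X A -> P X B -> P X (A `|` B);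
  Pi_bigcap (X : topologicalType) (A : nat -> set X) :
    (forall n, P X (A n)) -> P X (\bigcap_n A n) }.

(** With countable unions added, the conditions become stable under complementation. *)
Record projective_like (P : pointclass) : Prop := {
  projective_Pi_like :> Pi_like P;
  projective_bigcup (X : topologicalType) (A : nat -> set X) :
    (forall n, P X (A n)) -> P X (\bigcup_n A n) }.

Lemma Pi_set0 P (X : topologicalType) : Pi_like P -> P X set0.
Proof.
move=> PP; apply: (Pi_clopen PP); rewrite ?setC0; first exact: open0.
exact: openT.
Qed.

Lemma Pi_setT P (X : topologicalType) : Pi_like P -> P X setT.
Proof.
move=> PP; apply: (Pi_clopen PP); rewrite ?setCT; first exact: openT.
exact: open0.
Qed.

Lemma Pi_setI P (X : topologicalType) (A B : set X) :
  Pi_like P -> P X A -> P X B -> P X (A `&` B).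
Proof.
move=> PP PA PB; rewrite -bigcap2E; apply: (Pi_bigcap PP) => -[|[|n]] //=.
exact: Pi_setT.
Qed.

Lemma Pi0_2_like : Pi_like (Pi0 (cfin 2)).
Proof.
have two1 : cle (cfin 1) (cfin 2) by exact: cle_fin.
split; rewrite /Pi0.
- by move=> X Y h A hc SA; rewrite preimage_setC; exact: Sigma0_preimage.
- move=> X Y h A hi /(Sigma0_trace hi)[B SB hB].
  by exists (~` B); rewrite ?setCK // -preimage_setC hB setCK.
- by move=> X U _; exact: Sigma0_open.
- by move=> X A B SA SB; rewrite setCU; exact: Sigma0_setI.
- by move=> X A SA; rewrite setC_bigcap; exact: Sigma0_bigcup.
Qed.

Definition projection (P : pointclass) : pointclass :=
  fun T => [set pr B | B in @P (baire_space * T)%type].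

Definition dual (P : pointclass) : pointclass := fun T A => P T (~` A).

(** Complementation exchanges unions with intersections and maps clopen sets to clopen sets. *)
Lemma dual_projective_like P : projective_like P -> projective_like (dual P).
Proof.
move=> [PP Pcup]; split; rewrite /dual; first split.
- by move=> X Y h A hc PA; rewrite preimage_setC; exact: (Pi_preimage PP).
- move=> X Y h A hi /(Pi_trace PP hi)[B PB hB].
  by exists (~` B); rewrite ?setCK // -preimage_setC hB setCK.
- by move=> X U oU oU'; apply: (Pi_clopen PP); rewrite ?setCK.
- by move=> X A B PA PB; rewrite setCU; exact: Pi_setI.
- by move=> X A PA; rewrite setC_bigcap; exact: Pcup.
- by move=> X A PA; rewrite setC_bigcup; exact: (Pi_bigcap PP).
Qed.

Lemma continuous_pair (Z X Y : topologicalType) (f : Z -> X) (g : Z -> Y) :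
  continuous f -> continuous g -> continuous (fun z => (f z, g z)).
Proof.
move=> fc gc z.
by apply: (@cvg_pair _ _ _ (nbhs z) (nbhs (f z)) (nbhs (g z)));
  [exact: fc|exact: gc].
Qed.

Lemma fst_continuous (X Y : topologicalType) : continuous (@fst X Y).
Proof. by move=> q; exact: cvg_fst. Qed.

Lemma snd_continuous (X Y : topologicalType) : continuous (@snd X Y).
Proof. by move=> q; exact: cvg_snd. Qed.

Lemma coordinate_continuous (X : topologicalType) (n : nat) :
  continuous (fun q : baire_space * X => q.1 n).
Proof.
move=> q; apply: (@continuous_comp _ _ _ fst (fun p : baire_space => p n)).
  exact: fst_continuous.
exact: (@proj_continuous nat (fun=> nat)).
Qed.

Lemma coordinate_open (X : topologicalType) (n : nat) (D : set nat) :
  open [set q : baire_space * X | D (q.1 n)].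
Proof.
have /continuousP := @coordinate_continuous X n; apply; exact: discrete_open.
Qed.

Lemma reindex_continuous (X : topologicalType) (e : nat -> nat) :
  continuous (fun q : baire_space * X => (q.1 \o e : baire_space, q.2)).
Proof.
apply: continuous_pair; last exact: snd_continuous.
(* The product topology is the supremum of those induced by the coordinates. *)
move=> q; apply/cvg_sup => i.
apply: (@continuous_comp_initial _ _ _ (fun p : baire_space => p i)).
exact: coordinate_continuous.
Qed.

Lemma projection_choice P (X : topologicalType) (A : nat -> set X) :
  (forall n, projection P (A n)) ->
  exists C : nat -> set (baire_space * X),
    forall n, P _ (C n) /\ pr (C n) = A n.
Proof.
move=> PA; have /choice[C CP] n : exists C, P _ C /\ pr C = A n.
  by have [C] := PA n; exists C.
by exists C.
Qed.

(** Projecting gains closure under countable unions, so it can be alternated with [dual]. *)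
Lemma projection_projective_like P :
  Pi_like P -> projective_like (projection P).
Proof.
move=> PP.
have cup (X : topologicalType) (A : nat -> set X) :
    (forall n, projection P (A n)) -> projection P (\bigcup_n A n).
  move=> /projection_choice[C CP].
  (* {(p, x) | (shift p, x) \in C_(p 0)}, written as an intersection since P is
     only assumed closed under countable intersections and binary unions *)
  exists (\bigcap_n ([set q : baire_space * X | q.1 0 <> n] `|`
    (fun q : baire_space * X => (q.1 \o S : baire_space, q.2)) @^-1` C n)).
    apply: (Pi_bigcap PP) => n; apply: (Pi_setU PP).
      apply: (Pi_clopen PP).
        exact: (@coordinate_open X 0 [set k | k <> n]).
      exact: (@coordinate_open X 0 (~` [set k | k <> n])).
    apply: (Pi_preimage PP); first exact: reindex_continuous.
    by case: (CP n).
  apply/seteqP; split=> [x [p /= Cp]|x [n _]].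
    exists (p 0) => //; have [_ <-] := CP (p 0).
    by case: (Cp (p 0)) => // ?; exists (p \o S).
  have [_ <-] := CP n => -[p Cp].
  (* Prepending [n] to [p] selects [C n]; for [m] other than [n] the first alternative holds. *)
  exists (fun k => if k is k'.+1 then p k' else n) => m _ /=.
  by have [<-|] := pselect (n = m); [right|left].
split=> //; split=> //.
- move=> X Y h _ hc [B PB <-].
  exists ((fun q : baire_space * X => (q.1, h q.2)) @^-1` B) => //.
  apply: (Pi_preimage PP) => //; apply: continuous_pair.
    exact: fst_continuous.
  by move=> q; apply: continuous_comp; [exact: snd_continuous|exact: hc].
- move=> X Y h _ hi [C PC <-].
  have [B PB <-] := Pi_trace PP (initial_pair_snd (Z := baire_space) hi) PC.
  (* Projecting commutes by computation with pulling back along [h]. *)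
  by exists (pr B) => //; exists B.
- move=> X U oU oU'; exists (snd @^-1` U).
    have /continuousP sndU := @snd_continuous baire_space X.
    apply: (Pi_clopen PP); first exact: (sndU U).
    exact: (sndU (~` U)).
  by apply/seteqP; split=> [x []|x Ux] //; exists (fun=> 0).
- move=> X A B PA PB; rewrite -bigcup2E; apply: cup => -[|[|n]] //=.
  exists set0; last by apply/seteqP; split=> // x [].
  exact: Pi_set0.
- move=> X A /projection_choice[C CP].
  exists (\bigcap_n ((fun q : baire_space * X =>
    (q.1 \o (fun j => pickle (n, j)) : baire_space, q.2)) @^-1` C n)).
    apply: (Pi_bigcap PP) => n; apply: (Pi_preimage PP).
      exact: reindex_continuous.
    by case: (CP n).
  apply/seteqP; split=> [x [p Cp] n _|x Ax].
    by have [_ <-] := CP n; eexists; exact: Cp.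
  have /choice[p pC] n : exists p, C n (p, x).
    by have := Ax n I; have [_ <-] := CP n.
  (* One sequence whose n-th column is [p n]. *)
  exists (fun k => p (unpair k).1 (unpair k).2) => n _ /=.
  rewrite (_ : _ \o _ = p n); first exact: pC.
  by apply/funext => j /=; rewrite unpairK.
Qed.

(** By computation [Sigma1 1] is the projection of [Pi0 (cfin 2)], and each later class is the
    projection of the dual of the preceding one. *)
Lemma Sigma1_projective_like n : projective_like (Sigma1 n.+1).
Proof.
elim: n => [|n IH]; first exact: projection_projective_like Pi0_2_like.
exact: (projection_projective_like (dual_projective_like IH)).
Qed.

(** * Extension of functions into the power set of the naturals *)

(** Finite sets are given as lists, which form a countable type and so index a countable union. *)
Lemma Pomega_open_basic (U : set Pomega) (A : Pomega) : open U -> U A ->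
  exists s : seq nat, Pomega_basic [set` s] A /\ Pomega_basic [set` s] `<=` U.
Proof.
move=> [D Dfin <-] [F DF FA]; have /finite_seqP[s Fs] := Dfin _ DF.
by exists s; rewrite -Fs; split=> // B FB; exists F.
Qed.

Lemma Pomega_basic_open (n : nat) : open (Pomega_basic [set n]).
Proof.
exists [set [set n]]; first by move=> _ ->; exact: finite_set1.
by rewrite bigcup_set1.
Qed.

Lemma Pomega_extension (Y : topologicalType) (X : set Y) (G : pointclass)
    (f : X -> Pomega) :
  G Y set0 -> G Y setT ->
  (forall A B, G Y A -> G Y B -> G Y (A `&` B)) ->
  (forall A : nat -> set Y, (forall n, G Y (A n)) -> G Y (\bigcup_n A n)) ->
  (forall A : set X, G X A -> exists2 B, G Y B & set_val @^-1` B = A) ->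
  pc_measurable G f ->
  exists g : Y -> Pomega,
    (forall x : X, g (set_val x) = f x) /\ pc_measurable G g.
Proof.
move=> G0 GT GI Gcup Gtrace fG.
have /choice[B BP] n : exists B, G Y B /\
    set_val @^-1` B = f @^-1` Pomega_basic [set n].
  by have [B] := Gtrace _ (fG _ (Pomega_basic_open n)); exists B.
exists (fun y => [set n | B n y]); split=> [x|U oU].
  apply/seteqP; split=> n /=.
    by rewrite -[B n _]/((set_val @^-1` B n) x) (BP n).2; apply.
  move=> fxn; rewrite -[B n _]/((set_val @^-1` B n) x) (BP n).2.
  by move=> _ ->.
pose C (s : seq nat) : set Y := [set y | forall n, n \in s -> B n y].
have GC s : G Y (C s).
  elim: s => [|n s IH].
    by rewrite (_ : C _ = setT) //; apply/seteqP; split.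
  rewrite (_ : C _ = B n `&` C s); first by apply: GI => //; exact: (BP n).1.
  apply/seteqP; split=> [y Cy|y [By Cy] m].
    by split=> [|m ms]; apply: Cy; rewrite inE ?eqxx ?ms ?orbT.
  by rewrite inE => /orP[/eqP->|/Cy].
(* Numbers coding no list, and lists whose basic open set is not inside [U], contribute the empty
   set. *)
pose D (o : option (seq nat)) : set Y :=
  if o is Some s then [set y | Pomega_basic [set` s] `<=` U /\ C s y] else set0.
have -> : (fun y => [set n | B n y]) @^-1` U = \bigcup_k D (unpickle k).
  apply/seteqP; split=> [y /(Pomega_open_basic oU)[s [sy sU]]|y [k _]].
    by exists (pickle s) => //; rewrite pickleK.
  by case: unpickle => // s [sU Cy]; exact: sU.
apply: Gcup => k; case: unpickle => //= s.
have [sU|sU] := pselect (Pomega_basic [set` s] `<=` U).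
  by rewrite (_ : [set y | _] = C s) //; apply/seteqP; split=> [y []|].
by rewrite (_ : [set y | _] = set0) //; apply/seteqP; split=> [y []|].
Qed.

Theorem theorem3p1 (Y : topologicalType) (X : set Y) (G : pointclass)
    (f : X -> Pomega) :
  boldface G -> pc_measurable G f ->
  exists g : Y -> Pomega,
    (forall x : X, g (set_val x) = f x) /\ pc_measurable G g.
Proof.
have H (P : pointclass) (f' : X -> Pomega) :
    projective_like P -> pc_measurable P f' ->
    exists g : Y -> Pomega,
      (forall x : X, g (set_val x) = f' x) /\ pc_measurable P g.
  move=> PP; apply: Pomega_extension.
  - exact: Pi_set0 PP.
  - exact: Pi_setT PP.
  - by move=> A B; exact: Pi_setI PP.
  - exact: projective_bigcup.
  - move=> A; exact: (Pi_trace PP (@initial_set_val Y X)).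
(* The dummy index 0 is excluded by [1 <= n], leaving successor indices. *)
case=> [a a1|[//|n] _|[//|n] _].
- apply: Pomega_extension.
  + exact: Sigma0_set0.
  + exact: Sigma0_open openT.
  + by move=> A B; exact: Sigma0_setI.
  + by move=> A; exact: Sigma0_bigcup.
  + by move=> A; exact/Sigma0_trace/initial_set_val.
- exact/H/Sigma1_projective_like.
- exact/H/dual_projective_like/Sigma1_projective_like.
Qed.
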